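(* For all integers $n \geq 3$, \[ Z_{(1)}(K_n \times K_n) = n(n-2) + 2(n-2) = n^2 - 4 . \]
   Context: $K_n$ is the complete graph on $n$ vertices. The direct product $G \times H$ of graphs $G$ and $H$ has vertex set $V(G) \times V(H)$, and $(g,h)$ and $(g',h')$ are adjacent if and only if $gg' \in E(G)$ and $hh' \in E(H)$. Forcing: a set $B \subseteq V(G)$ is initially colored blue and all other vertices are uncolored. Color change rule: a blue vertex $v$ can force (color blue) an uncolored neighbor $u$ if $u$ is the only uncolored neighbor of $v$. The rule is applied repeatedly. Leaky forcing: for an integer $\ell \geq 0$, a leak is a vertex that is not allowed to force any neighbor, even if it satisfies the color change rule (a leak may itself be colored or be forced by others). A set $B \subseteq V(G)$ is an $\ell$-leaky forcing set if, for every choice of $\ell$ vertices of $G$ as leaks (chosen after $B$ is fixed), starting from $B$ blue, all vertices of $G$ can eventually be forced using only forces by non-leak vertices. $Z_{(\ell)}(G)$ is the minimum cardinality of an $\ell$-leaky forcing set of $G$. *)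

(* Defs.v *)
From mathcomp Require Import all_boot.

Set Implicit Arguments.
Unset Strict Implicit.
Unset Printing Implicit Defensive.

(* A simple graph on the finite vertex type T is given by its adjacency       *)
(* relation e : rel T, assumed symmetric and irreflexive.                     *)

Definition complete_graph (n : nat) : rel 'I_n := [rel i j | i != j].

Definition direct_product (T1 T2 : finType) (e1 : rel T1) (e2 : rel T2) :
    rel (T1 * T2) :=
  [rel x y | e1 x.1 y.1 && e2 x.2 y.2].

Section LeakyForcing.

Variables (T : finType) (e : rel T).

(* With blue set S, the vertex v may force u when v is blue and u is the only *)
(* vertex of the uncolored neighborhood of v.                                 *)
Definition can_force (S : {set T}) (v u : T) : bool :=
  (v \in S) && ([set w | e v w & w \notin S] == [set u]).

(* One application of the rule by a non-leak: the blue set S becomes S'.      *)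
Definition force_step (L : {set T}) : rel {set T} :=
  [rel S S' | [exists v, exists u,
     [&& v \notin L, can_force S v u & S' == u |: S]]].

(* connect is reflexive-transitive closure: some finite sequence of forces    *)
(* turns B into the whole vertex set.                                         *)
Definition leaky_forcing_set (l : nat) (B : {set T}) : bool :=
  [forall (L : {set T} | #|L| == l), connect (force_step L) B [set: T]].

Definition leaky_forcing_number (l : nat) : nat :=
  #|[arg min_(B < [set: T] | leaky_forcing_set l B) #|B|]|.

(* The default [set: T] above is admissible, so the minimum is genuine.       *)
Lemma leaky_forcing_setT (l : nat) : leaky_forcing_set l [set: T].
Proof. by apply/forall_inP=> L _; apply: connect0. Qed.

End LeakyForcing.

Lemma complete_graph_sym (n : nat) : symmetric (@complete_graph n).
Proof. by move=> i j; rewrite /complete_graph /= eq_sym. Qed.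

Lemma complete_graph_irr (n : nat) : irreflexive (@complete_graph n).
Proof. by move=> i; rewrite /complete_graph /= eqxx. Qed.

Lemma direct_product_sym (T1 T2 : finType) (e1 : rel T1) (e2 : rel T2) :
  symmetric e1 -> symmetric e2 -> symmetric (direct_product e1 e2).
Proof. by move=> s1 s2 x y; rewrite /direct_product /= s1 s2. Qed.

Lemma direct_product_irr (T1 T2 : finType) (e1 : rel T1) (e2 : rel T2) :
  irreflexive e1 -> irreflexive (direct_product e1 e2).
Proof. by move=> i1 x; rewrite /direct_product /= i1. Qed.

(* Main.v *)
Require Import Defs.
From mathcomp Require Import all_boot all_algebra.

(** Why the number is n ^ 2 - 4.

    Lower bound.  Leaks only make forcing harder, and even without leaks at
    most four vertices can start uncolored.  The vertices (i, j) and (k, l) are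
    adjacent exactly when (i - k) * (j - l) is nonzero, and the matrix M with
    these entries has rank at most 4, because (i - k) * (j - l) is a
    combination of 1, i, j and i * j with coefficients depending on (k, l) only.
    If five or more vertices are uncolored, some nonzero vector c supported on
    them satisfies M c = 0.  When v forces u, row v of M c = 0 reduces to
    M v u * c u = 0, so c vanishes at u as well: c stays supported on uncolored
    vertices, and forcing can never color everything.  This argument is
    [forcing_rank_bound], applied to the representation built by
    [complete_graph_represents] and [direct_product_represents].

    Upper bound.  Leave uncolored four cells of the top left 3 x 3 corner,
<<
        0 1 2
      0 W W .
      1 . . W
      2 W . .
>>
    Two forcing sequences color them, and no vertex performs a force in both.
    A single leak therefore spoils at most one of the two
    ([one_leaky_of_two_clearings]). *)

Set Implicit Arguments.
Unset Strict Implicit.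
Unset Printing Implicit Defensive.

Section LeakyForcingNumber.

Variables (T : finType) (e : rel T).

Lemma leaky_forcing_number_eq l k (B : {set T}) :
    leaky_forcing_set e l B -> #|B| = k ->
    (forall C : {set T}, leaky_forcing_set e l C -> k <= #|C|) ->
  leaky_forcing_number e l = k.
Proof.
move=> leakyB cardB min_k; rewrite /leaky_forcing_number.
case: arg_minnP => [|A leakyA minA]; first exact: leaky_forcing_setT.
by apply/eqP; rewrite eqn_leq min_k // -{1}cardB minA.
Qed.

End LeakyForcingNumber.

(** * The rank bound on uncolored vertices *)

Section Rank.

Import GRing.Theory.
Local Open Scope ring_scope.

(** The product of the matrices p and q has the zero pattern of the adjacency
    matrix of e, including zeros on the diagonal when e is irreflexive; its
    rank is at most #|I|. *)
Definition represents (F : fieldType) (T I : finType) (e : rel T)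
    (p : T -> I -> F) (q : I -> T -> F) : Prop :=
  forall v w, e v w = (\sum_k p v k * q k w != 0).

(** More unknowns than equations. *)
Lemma dependency_in (F : fieldType) (T I : finType) (q : I -> T -> F)
    (W : {set T}) :
  (#|I| < #|W|)%N ->
  exists c : T -> F, [/\ exists w, c w != 0,
    forall w, w \notin W -> c w = 0 & forall k, \sum_w q k w * c w = 0].
Proof.
move=> ltIW.
pose A := \matrix_(i < #|W|, j < #|I|) q (enum_val j) (enum_val i).
have kerA0 : kermx A != 0.
  rewrite -mxrank_eq0 mxrank_ker -lt0n subn_gt0.
  exact: leq_ltn_trans (rank_leq_col A) ltIW.
have /rowV0Pn[u /sub_kermxP uA0 /rV0Pn[i0 ui0]] := kerA0.
exists (fun w => \sum_i u 0 i *+ (enum_val i == w)); split.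
- exists (enum_val i0); rewrite (bigD1 i0) //= eqxx big1 ?addr0 // => i ne_i.
  by rewrite (inj_eq enum_val_inj) (negbTE ne_i).
- move=> w wW; apply: big1 => i _; case: eqP => // def_w.
  by rewrite -def_w enum_valP in wW.
- move=> k; have /rowP/(_ (enum_rank k)) := uA0.
  rewrite !mxE => uAk; rewrite -[RHS]uAk.
  under eq_bigr do rewrite mulr_sumr.
  rewrite exchange_big /=; apply: eq_bigr => i _.
  rewrite mxE enum_rankK mulrC (bigD1 (enum_val i)) //= eqxx big1 ?addr0 //.
  by move=> w ne_w; rewrite eq_sym (negbTE ne_w) mulr0.
Qed.

Section Forcing.

Variables (F : fieldType) (T I : finType) (e : rel T).
Variables (p : T -> I -> F) (q : I -> T -> F).
Hypothesis rep : represents e p q.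

(** In the row equation of the forcing vertex v, the blue vertices contribute 0
    because c vanishes there, and the uncolored ones other than u because they
    are not adjacent to v. *)
Lemma force_step_vanishing (L S S' : {set T}) (c : T -> F) :
    (forall k, \sum_w q k w * c w = 0) -> force_step e L S S' ->
  {in S, forall w, c w = 0} -> {in S', forall w, c w = 0}.
Proof.
move=> qc0 /existsP[v /existsP[u /and3P[_ /andP[_ /eqP force_u] /eqP->]]] cS0.
move=> w /setU1P[->{w}|]; last exact: cS0.
have : \sum_w (\sum_k p v k * q k w) * c w = 0.
  under eq_bigr do rewrite mulr_suml.
  rewrite exchange_big big1 // => k _.
  under eq_bigr do rewrite -mulrA.
  by rewrite -mulr_sumr qc0 mulr0.
have /andP[e_vu _] : e v u && (u \notin S).
  by have := set11 u; rewrite -force_u inE.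
rewrite (bigD1 u) //= [X in _ + X]big1 => [|w ne_wu]; last first.
  have [/cS0->|wS] := boolP (w \in S); first by rewrite mulr0.
  have : w \notin [set u] by rewrite inE.
  by rewrite -force_u inE wS andbT rep negbK => /eqP->; rewrite mul0r.
rewrite rep in e_vu.
by move/eqP; rewrite addr0 mulf_eq0 (negbTE e_vu) => /eqP.
Qed.

Lemma forcing_rank_bound (L B : {set T}) :
  connect (force_step e L) B [set: T] -> (#|~: B| <= #|I|)%N.
Proof.
case/connectP=> s; rewrite leqNgt => path_s last_s.
apply/negP=> /(dependency_in q)[c [[w cw] cB0 qc0]].
have {cB0} : {in B, forall w, c w = 0}.
  by move=> x xB; apply: cB0; rewrite inE negbK.
elim: s B path_s last_s => [|S s IHs] B /= => [_ <- cT0|].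
  by rewrite cT0 ?eqxx in cw.
case/andP=> step_S path_s last_s /(force_step_vanishing qc0 step_S).
exact: IHs.
Qed.

(** Any set of l leaks will do, and l <= #|T| provides one. *)
Lemma leaky_forcing_rank_bound (l : nat) (B : {set T}) :
  (l <= #|T|)%N -> leaky_forcing_set e l B -> (#|T| - #|I| <= #|B|)%N.
Proof.
move=> le_lT /forall_inP leakyB.
have card_take : #|[set x in take l (enum T)]| == l.
  rewrite cardsE (card_uniqP _) ?take_uniq ?enum_uniq //.
  by rewrite size_takel // -cardE.
have := forcing_rank_bound (leakyB _ card_take).
by rewrite leq_subLR addnC -(cardsC B) leq_add2l.
Qed.

End Forcing.

(** The entries i - j vanish exactly on the diagonal and form a matrix of
    rank 2, which is why the index type is bool. *)
Lemma complete_graph_represents n :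
  represents (@complete_graph n)
    (fun i b => if b then i%:R else 1 : rat)
    (fun b j => if b then 1 else - j%:R).
Proof.
by move=> i j; rewrite big_bool /= mulr1 mul1r subr_eq0 Num.Theory.eqr_nat.
Qed.

(** This is the tensor product of the two matrices: its entries factor as
    products of entries, and its rank is at most #|I1| * #|I2|. *)
Lemma direct_product_represents (F : fieldType) (T1 T2 I1 I2 : finType)
    (e1 : rel T1) (e2 : rel T2) (p1 : T1 -> I1 -> F) (q1 : I1 -> T1 -> F)
    (p2 : T2 -> I2 -> F) (q2 : I2 -> T2 -> F) :
    represents e1 p1 q1 -> represents e2 p2 q2 ->
  represents (direct_product e1 e2)
    (fun v k => p1 v.1 k.1 * p2 v.2 k.2) (fun k w => q1 k.1 w.1 * q2 k.2 w.2).
Proof.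
move=> rep1 rep2 v w; rewrite /direct_product /= rep1 rep2 -negb_or -mulf_eq0.
rewrite big_distrlr /= pair_bigA /=.
by under [in RHS]eq_bigr do rewrite mulrACA.
Qed.

End Rank.

(** * Forcing sequences and a single leak *)

Section Clearing.

Variables (T : finType) (e : rel T).

(** Each item (v, u) of s is a force of u by v; ws lists the vertices still
    uncolored.  Working with explicit lists lets concrete sequences be checked
    by computation, even inside a graph of unspecified size. *)
Fixpoint clears (ws : seq T) (s : seq (T * T)) : bool :=
  if s is (v, u) :: s' then
    [&& v \notin ws, filter (e v) ws == [:: u]
      & clears (filter (predC1 u) ws) s']
  else ws == [::].

Lemma clears_connect (L : {set T}) ws s :
    clears ws s -> {in unzip1 s, forall v, v \notin L} ->
  connect (force_step e L) (~: [set x in ws]) [set: T].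
Proof.
elim: s ws => [|[v u] s IHs] ws /=.
  move=> /eqP-> _; suff -> : ~: [set x in [::]] = [set: T] by apply: connect0.
  by apply/setP=> x; rewrite !inE.
case/and3P=> v_ws /eqP vws_u /IHs{}IHs s_L.
have : {in unzip1 s, forall x, x \notin L}.
  by move=> x xs; rewrite s_L ?inE ?xs ?orbT.
move=> /IHs{IHs}.
apply/connect_trans/connect1/existsP; exists v; apply/existsP; exists u.
rewrite (s_L v (mem_head _ _)) /can_force !inE v_ws /=; apply/andP; split.
  by apply/eqP/setP=> x; rewrite !inE negbK -mem_filter vws_u inE.
by apply/eqP/setP=> x; rewrite !inE mem_filter negb_and negbK.
Qed.

Lemma one_leaky_of_two_clearings ws s1 s2 :
    clears ws s1 -> clears ws s2 -> ~~ has [in unzip1 s1] (unzip1 s2) ->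
  leaky_forcing_set e 1 (~: [set x in ws]).
Proof.
move=> cl1 cl2 dis; apply/forall_inP=> L /cards1P[x ->].
have avoid s : clears ws s -> x \notin unzip1 s ->
    connect (force_step e [set x]) (~: [set x in ws]) [set: T].
  move=> cl xs; apply: (clears_connect cl) => v vs; rewrite inE.
  by apply: contraNneq xs => <-.
have [x1|] := boolP (x \in unzip1 s1); last exact: avoid.
by apply: avoid cl2 _; apply: contra dis => x2; apply/hasP; exists x.
Qed.

End Clearing.

(** * The direct product of two complete graphs *)

(** The numerals are explicit ordinals, and not images of nat under inord, so
    that comparisons between corner cells compute although m is a variable. *)
Definition uncolored_corner m : seq ('I_m.+3 * 'I_m.+3) :=
  let o0 := Ordinal (isT : 0 < m.+3) in
  let o1 := Ordinal (isT : 1 < m.+3) in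
  let o2 := Ordinal (isT : 2 < m.+3) in
  [:: (o0, o0); (o0, o1); (o1, o2); (o2, o0)].

Lemma corner_leaky m :
  leaky_forcing_set
    (direct_product (@complete_graph m.+3) (@complete_graph m.+3)) 1
    (~: [set x in uncolored_corner m]).
Proof.
pose o0 := Ordinal (isT : 0 < m.+3).
pose o1 := Ordinal (isT : 1 < m.+3).
pose o2 := Ordinal (isT : 2 < m.+3).
(* The sequences start from the only two cells able to force at all,
   (0, 2) and (1, 0); the later forcers are chosen to avoid repetitions. *)
pose s1 := [:: ((o0, o2), (o2, o0)); ((o1, o1), (o0, o0));
               ((o0, o0), (o1, o2)); ((o2, o0), (o0, o1))].
pose s2 := [:: ((o1, o0), (o0, o1)); ((o2, o2), (o0, o0));
               ((o2, o1), (o1, o2)); ((o1, o2), (o2, o0))].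
exact: (@one_leaky_of_two_clearings _ _ _ s1 s2).
Qed.

Theorem theorem2p5 (n : nat) (hn : 3 <= n) :
  leaky_forcing_number
    (direct_product (@complete_graph n) (@complete_graph n)) 1
    = n * (n - 2) + 2 * (n - 2)
  /\ n * (n - 2) + 2 * (n - 2) = n ^ 2 - 4.
Proof.
have sq : n * (n - 2) + 2 * (n - 2) = n ^ 2 - 4.
  by rewrite -mulnDl mulnC -subn_sqr.
split=> //; rewrite {}sq; case: n hn => [|[|[|m]]] // _.
have cardT : #|{: 'I_m.+3 * 'I_m.+3}| = m.+3 ^ 2 by rewrite card_prod card_ord.
apply: leaky_forcing_number_eq (corner_leaky m) _ _.
  rewrite cardsCs setCK cardT cardsE; congr (_ - _).
  exact: (card_uniqP (isT : uniq (uncolored_corner m))).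
move=> C leakyC; rewrite -cardT.
have rep := direct_product_represents (@complete_graph_represents m.+3)
  (@complete_graph_represents m.+3).
have <- : #|{: bool * bool}| = 4 by rewrite card_prod card_bool.
by apply: (leaky_forcing_rank_bound rep _ leakyC); rewrite cardT.
Qed.
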